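(* Let $(M,W,P,Q)$ be a polygamous market in which all preferences are strict, and let $\mu$ be a matching returned by the algorithm PolyGS (with men proposing, quotas on both sides). Then $\mu$ is man-optimal: for every stable matching $\mu'$, every man $m\in M$ and every $i\in\{1,\dots,q_m\}$, $$\mu(m)_i\ \geq_m\ \mu'(m)_i,$$ where $\mu(m)$ and $\mu'(m)$ are each filled with copies of $m$ up to size $q_m$ and listed from best to worst according to $\geq_m$, and $\mu(m)_i$, $\mu'(m)_i$ denote the $i$-th entries of these lists. Moreover, PolyGS returns a unique result, i.e. the returned matching does not depend on the order in which the men propose.
   Context: **Market.** A polygamous market $(M,W,P,Q)$ consists of disjoint finite sets $M$ (men) and $W$ (women); for each person $p\in M\cup W$ a quota $q_p\in\mathbb{Z}_{\ge 0}$ (these form $Q$); and for each person a preference relation (these form $P$). The preference $P(m)$ of a man $m$ is a complete transitive relation (total preorder) $\geq_m$ on $W\cup\{m\}$, with associated indifference $=_m$ and strict preference $>_m$; the preference $P(w)$ of a woman $w$ is likewise a total preorder $\geq_w$ on $M\cup\{w\}$. Preferences are strict if indifference coincides with equality (i.e. each $\geq_p$ is a total order). Person $p_1$ is acceptable to $p$ if $p_1>_p p$. For a person $p_1$ and a finite (multi)set of persons $K$, write $p_1>_p K$ if there exists $\tau\in K$ with $p_1>_p\tau$. **Valid matching.** A (valid) matching is a set $\mu\subseteq M\times W$ (so each pair occurs at most once) with $|\mu(w)|\le q_w$ for all $w\in W$ and $|\mu(m)|\le q_m$ for all $m\in M$, where $\mu(w)=\{m\mid (m,w)\in\mu\}$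 and $\mu(m)=\{w\mid (m,w)\in\mu\}$. By convention, $\mu(p)$ is then filled up with copies of $p$ to a multiset of size exactly $q_p$ (unused spots of $p$ count as $p$ matched to itself). **Stability.** Let $\mu(p)$ be filled up with copies of $p$ to a multiset of size exactly $q_p$, for every person $p$. Then $\mu$ is unstable if there is a pair $(m,w)\in (M\times W)\cup\{(m,m)\mid m\in M\}\cup\{(w,w)\mid w\in W\}$ such that ($m=w$ or $m\notin\mu(w)$), $w>_m\mu(m)$ and $m>_w\mu(w)$. Such a pair is called a blocking pair. A stable matching is a valid matching that is not unstable. **Algorithm PolyGS (men propose).** The state is a multiset $\mu$ of pairs in $(M\times W)\cup\{(p,p)\mid p\in M\cup W\}$; during the run, $\mu(p)$ denotes the multiset of current partners of $p$ (including copies of $p$ coming from pairs $(p,p)$), not otherwise filled up. Initially $\mu$ contains $(w,w)$ exactly $q_w$ times for each $w\in W$ and nothing else. While there is a man $m$ with $|\mu(m)|<q_m$, choose any such $m$ and do the following. Let $w$ be the most preferred (according to $\geq_m$) woman among those acceptable to $m$ to whom $m$ has not yet proposed; if there is no such woman, let $w=m$. If $w=m$, add one copy of $(m,m)$ to $\mu$. Otherwise $m$ proposes to $w$: if $m>_w\mu(w)$, let $m'$ be the least preferred element of $\mu(w)$ according to $\geq_w$ (possibly $w$ herself), remove one copy of $(m',w)$ from $\mu$ and add $(m,w)$; if not $m>_w\mu(w)$, the proposal is rejected and $\mu$ is unchanged. When the loop ends, return $\mu$, whose man-woman pairs constitute the returned matching (self-pairs represent unused spots). The only freedom under strict preferences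 is the choice of the man $m$ in each iteration. *)

(* Defs.v *)
From Stdlib Require Export Relation_Operators.
From mathcomp Require Export all_boot.
From mathcomp Require Export finmap multiset.

Set Implicit Arguments.
Unset Strict Implicit.
Unset Printing Implicit Defensive.

Local Open Scope mset_scope.
Local Open Scope nat_scope.

(* The set W ∪ {m} ranked by a man m is [option W], with [None] standing for
   m himself; dually for women.  [man_pref m x y] means x >=_m y. *)
Record market (M W : finType) := Market {
  man_quota : M -> nat;
  woman_quota : W -> nat;
  man_pref : M -> rel (option W);
  woman_pref : W -> rel (option M);
  man_pref_total : forall m, total (man_pref m);
  man_pref_trans : forall m, transitive (man_pref m);
  woman_pref_total : forall w, total (woman_pref w);
  woman_pref_trans : forall w, transitive (woman_pref w) }.

Definition strict_preferences (M W : finType) (mkt : market M W) : Prop :=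
  (forall m, antisymmetric (man_pref mkt m)) /\
  (forall w, antisymmetric (woman_pref mkt w)).

Definition strictly (T : Type) (ge : rel T) : rel T := fun x y => ~~ ge y x.

(* x > K for a multiset K, listed as a sequence. *)
Definition prefers (T : Type) (ge : rel T) (x : T) (K : seq T) : bool :=
  has (strictly ge x) K.

(* The pairs (M × W) ∪ {(p,p) | p in M ∪ W}: [inl (m, w)] is (m,w) and
   [inr p] is (p,p). *)
Definition pairing (M W : finType) : finType := ((M * W) + (M + W))%type.

Definition man_pair (M W : finType) (m : M) (x : option W) : pairing M W :=
  if x is Some w then inl (m, w) else inr (inl m).

Definition woman_pair (M W : finType) (w : W) (y : option M) : pairing M W :=
  if y is Some m then inl (m, w) else inr (inr w).

Section Matchings.
Variables (M W : finType) (mkt : market M W).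
Implicit Types (mu : {set M * W}) (m : M) (w : W).

Definition wives mu m : {set W} := [set w | (m, w) \in mu].
Definition husbands mu w : {set M} := [set m | (m, w) \in mu].

Definition valid_matching mu : Prop :=
  (forall w, #|husbands mu w| <= woman_quota mkt w) /\
  (forall m, #|wives mu m| <= man_quota mkt m).

Definition filled_man mu m : seq (option W) :=
  [seq Some w | w <- enum (wives mu m)]
    ++ nseq (man_quota mkt m - #|wives mu m|) None.

Definition filled_woman mu w : seq (option M) :=
  [seq Some m | m <- enum (husbands mu w)]
    ++ nseq (woman_quota mkt w - #|husbands mu w|) None.

Definition blocking_pair mu (p : pairing M W) : bool :=
  match p with
  | inl (m, w) =>
      [&& (m, w) \notin mu,
          prefers (man_pref mkt m) (Some w) (filled_man mu m)
        & prefers (woman_pref mkt w) (Some m) (filled_woman mu w)]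
  | inr (inl m) => prefers (man_pref mkt m) None (filled_man mu m)
  | inr (inr w) => prefers (woman_pref mkt w) None (filled_woman mu w)
  end.

Definition unstable mu : Prop := exists p, blocking_pair mu p.

Definition stable_matching mu : Prop := valid_matching mu /\ ~ unstable mu.

(* Sorting along >=_m lists the partners from best to worst. *)
Definition ranked_man mu m : seq (option W) :=
  sort (man_pref mkt m) (filled_man mu m).

(* The list entries are numbered from 0. *)
Definition man_optimal mu : Prop :=
  forall mu', stable_matching mu' ->
  forall m i, i < man_quota mkt m ->
    man_pref mkt m (nth None (ranked_man mu m) i) (nth None (ranked_man mu' m) i).

End Matchings.

Section PolyGS.
Variables (M W : finType) (mkt : market M W).
Implicit Types (mu : {mset pairing M W}) (m : M) (w : W).

Definition man_partners mu m : seq (option W) :=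
  flatten [seq nseq (mu (man_pair m x)) x | x <- enum {: option W}].

Definition woman_partners mu w : seq (option M) :=
  flatten [seq nseq (mu (woman_pair w y)) y | y <- enum {: option M}].

Record state := State {
  pairs : {mset pairing M W};
  proposed : {set M * W} }.

Definition initial_state : state :=
  State (seq_mset (flatten [seq nseq (woman_quota mkt w) (woman_pair w None)
                           | w <- enum W]))
        set0.

Definition free_man (s : state) m : bool :=
  size (man_partners (pairs s) m) < man_quota mkt m.

Definition candidate (s : state) m w : bool :=
  strictly (man_pref mkt m) (Some w) None && ((m, w) \notin proposed s).

Definition best_candidate (s : state) m w : Prop :=
  candidate s m w /\
  forall w', candidate s m w' -> man_pref mkt m (Some w) (Some w').

Definition least_preferred mu w (y : option M) : Prop :=
  y \in woman_partners mu w /\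
  forall z, z \in woman_partners mu w -> woman_pref mkt w z y.

Definition willing (s : state) m w : bool :=
  prefers (woman_pref mkt w) (Some m) (woman_partners (pairs s) w).

(* One iteration of the loop, for an arbitrary choice of the man m. *)
Inductive PolyGS_step (s : state) : state -> Prop :=
| step_self m :
    free_man s m -> (forall w, ~~ candidate s m w) ->
    PolyGS_step s (State (man_pair m None +` pairs s) (proposed s))
| step_accept m w y :
    free_man s m -> best_candidate s m w ->
    willing s m w -> least_preferred (pairs s) w y ->
    PolyGS_step s (State (man_pair m (Some w) +` (pairs s `\ woman_pair w y))
                         ((m, w) |: proposed s))
| step_reject m w :
    free_man s m -> best_candidate s m w -> ~~ willing s m w ->
    PolyGS_step s (State (pairs s) ((m, w) |: proposed s)).

Definition PolyGS_returns mu : Prop :=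
  exists s : state,
    [/\ clos_refl_trans state PolyGS_step initial_state s,
        forall m, ~~ free_man s m
      & mu = pairs s].

Definition matching_of mu : {set M * W} := [set p | inl p \in mu].

End PolyGS.

(* Main.v *)
From Stdlib Require Import Operators_Properties.
Require Import Defs.

(** A woman only trades up during the run, so the men she has rejected are
    worse than her current partners; hence a pair rejected by the algorithm
    belongs to no stable matching.  A man proposes in decreasing order of
    preference, so in the end he keeps every stable partner better than his
    worst spot, which gives optimality.  The returned matching is itself stable:
    two results therefore dominate each other and coincide by antisymmetry. *)

Set Implicit Arguments.
Unset Strict Implicit.
Unset Printing Implicit Defensive.

Local Open Scope mset_scope.
Local Open Scope nat_scope.

(** * Counting in filled and sorted lists *)

Section Sequences.

Lemma count_flatten_nseq (T : finType) (f : T -> nat) (x : T) :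
  count_mem x (flatten [seq nseq (f y) y | y <- enum T]) = f x.
Proof.
rewrite count_flatten -map_comp sumn_map big_enum (bigD1 x) //= count_nseq /= eqxx.
by rewrite big1 ?mul1n ?addn0 // => y /negPf yx; rewrite count_nseq /= yx.
Qed.

Lemma mem_flatten_nseq (T : finType) (f : T -> nat) (x : T) :
  (x \in flatten [seq nseq (f y) y | y <- enum T]) = (0 < f x).
Proof. by rewrite -has_pred1 has_count count_flatten_nseq. Qed.

Lemma size_flatten_nseq (T : finType) (f : T -> nat) :
  size (flatten [seq nseq (f y) y | y <- enum T]) = \sum_y f y.
Proof.
rewrite size_flatten /shape -map_comp sumn_map big_enum.
by apply: eq_bigr => y _; rewrite /= size_nseq.
Qed.

Lemma sum_pred1 (T : finType) (x : T) : \sum_y (y == x) = 1.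
Proof. by rewrite (bigD1 x) //= eqxx big1 // => y /negPf ->. Qed.

Lemma count_Some_enum (T : finType) (A : {set T}) (x : T) :
  count_mem (Some x) [seq Some y | y <- enum A] = (x \in A).
Proof.
rewrite count_map (eq_count (a2 := pred1 x)) // count_uniq_mem ?enum_uniq //.
by rewrite mem_enum.
Qed.

Lemma count_None_enum (T : finType) (A : {set T}) :
  count_mem None [seq Some y | y <- enum A] = 0.
Proof. by rewrite count_map (eq_count (a2 := pred0)) // count_pred0. Qed.

(** Lists with equal multiplicities are permutations of each other. This links partner lists read
    off a state to the filled lists of a set matching. *)
Lemma perm_fill (T : finType) (A : {set T}) (s : seq (option T)) :
  (forall x, count_mem (Some x) s = (x \in A)) ->
  perm_eq s ([seq Some x | x <- enum A] ++ nseq (count_mem None s) None).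
Proof.
move=> sA; apply/allP => -[x|] _; rewrite /= count_cat count_nseq.
  by rewrite sA count_Some_enum addn0.
by rewrite count_None_enum mul1n.
Qed.

Lemma size_fill (T : finType) (A : {set T}) (s : seq (option T)) :
  (forall x, count_mem (Some x) s = (x \in A)) ->
  size s = #|A| + count_mem None s.
Proof.
by move/perm_fill/perm_size ->; rewrite size_cat size_map size_nseq cardE.
Qed.

Lemma perm_fill_size (T : finType) (A : {set T}) (s : seq (option T)) :
  (forall x, count_mem (Some x) s = (x \in A)) ->
  perm_eq s ([seq Some x | x <- enum A] ++ nseq (size s - #|A|) None).
Proof. by move=> sA; rewrite (size_fill sA) addKn; apply: perm_fill. Qed.

Variables (T : eqType) (ge : rel T) (x0 : T).
Hypothesis ge_trans : transitive ge.

(** In a list sorted from best to worst, the entries at least as good as [b] form an initial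
    segment. Comparing entries by rank thus reduces to comparing counts. *)
Lemma sorted_nth_count (b : T) (s : seq T) i :
  sorted ge s -> i < size s ->
  ge (nth x0 s i) b = (i < count (fun x => ge x b) s).
Proof.
move=> s_sorted; elim: s s_sorted i => // x s IHs s_path i lt_i.
have le_x y : y \in s -> ge x y.
  by move: (order_path_min ge_trans s_path) => /allP; apply.
have {}IHs := IHs (path_sorted s_path).
have [xb|xb] := boolP (ge x b); rewrite /= ?xb.
  by case: i lt_i => [|i] lt_i //=; rewrite IHs.
have /eqP -> : count (fun y => ge y b) s == 0.
  rewrite eqn0Ngt -has_count; apply/hasPn => y /le_x xy.
  by apply: contra xb; apply: ge_trans.
rewrite (negPf xb) addn0 ltn0; apply/negbTE; case: i lt_i => //= i lt_i.
by apply: contra xb; apply: ge_trans; apply/le_x/mem_nth.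
Qed.

End Sequences.

(** * Partners in a multiset of pairs *)

Section Pairings.
Variables (M W : finType).
Implicit Types (mu : {mset pairing M W}) (m : M) (w : W).

Lemma man_pair_inj m m' x x' :
  (man_pair m x == man_pair m' x' :> pairing M W) = (m == m') && (x == x').
Proof. by case: x x' => [w|] [w'|] //=; rewrite ?andbT ?andbF. Qed.

Lemma woman_pair_inj w w' y y' :
  (woman_pair w y == woman_pair w' y' :> pairing M W) = (w == w') && (y == y').
Proof.
by case: y y' => [m|] [m'|] //=; rewrite ?andbT ?andbF // andbC.
Qed.

Lemma mem_man_partners mu m x :
  (x \in man_partners mu m) = (man_pair m x \in mu).
Proof. by rewrite mem_flatten_nseq in_mset. Qed.

Lemma mem_woman_partners mu w y :
  (y \in woman_partners mu w) = (woman_pair w y \in mu).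
Proof. by rewrite mem_flatten_nseq in_mset. Qed.

(** Under this condition, passing from the multiset to the set [matching_of mu] loses no
    multiplicity of a man-woman pair. *)
Definition simple mu : Prop := forall m w, mu (inl (m, w)) <= 1.

Lemma simpleE mu m w : simple mu -> mu (inl (m, w)) = (inl (m, w) \in mu).
Proof. by move/(_ m w); rewrite in_mset; case: (mu _) => [|[]]. Qed.

Lemma count_man_partners mu m w : simple mu ->
  count_mem (Some w) (man_partners mu m) = (w \in wives (matching_of mu) m).
Proof. by move=> ?; rewrite count_flatten_nseq !inE /= simpleE. Qed.

Lemma count_woman_partners mu w m : simple mu ->
  count_mem (Some m) (woman_partners mu w) = (m \in husbands (matching_of mu) w).
Proof. by move=> ?; rewrite count_flatten_nseq !inE /= simpleE. Qed.

Lemma size_man_partners_add mu m z m' :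
  size (man_partners (man_pair m z +` mu) m') = (m' == m) + size (man_partners mu m').
Proof.
rewrite !size_flatten_nseq (eq_bigr (fun x => (m' == m) * (x == z) + mu (man_pair m' x))).
  by rewrite big_split /= -big_distrr /= sum_pred1 muln1.
by move=> x _; rewrite mset1DE man_pair_inj mulnb.
Qed.

Lemma size_woman_partners_swap mu w m y w' : y \in woman_partners mu w ->
  size (woman_partners (woman_pair w (Some m) +` (mu `\ woman_pair w y)) w')
  = size (woman_partners mu w').
Proof.
(* Adding the indicator of [w' = w] to both sides avoids subtraction: on the left it restores the
   removed copy of [y], on the right it accounts for the new copy of [Some m]. *)
rewrite mem_woman_partners in_mset => y_in; apply: (@addIn (w' == w)).
have sum_delta (z : option M) : \sum_x (w' == w) * (x == z) = (w' == w).
  by rewrite -big_distrr /= sum_pred1 muln1.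
rewrite !size_flatten_nseq -[in LHS](sum_delta y) -[in RHS](sum_delta (Some m)).
rewrite -!big_split /=; apply: eq_bigr => x _.
rewrite mset1DE msetB1E -[inl _]/(woman_pair w (Some m)) !woman_pair_inj.
rewrite !mulnb addnC [RHS]addnC addnCA; congr (_ + _).
by rewrite subnKC //; case: eqP => //= ->; case: eqP => //= ->.
Qed.

End Pairings.

(** * The invariant of a run and the preference orders *)

Section Market.
Variables (M W : finType) (mkt : market M W).
Hypothesis hstrict : strict_preferences mkt.
Implicit Types (mu : {mset pairing M W}) (nu : {set M * W}) (s : state M W).
Implicit Types (m : M) (w : W).

(** The fields that carry the argument: each man proposes downwards without skipping ([inv_above]),
    takes himself only once no candidate is left ([inv_single]), and a man who has proposed without
    being held is no better than any current partner of the woman ([inv_rejected]). *)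
Record invariant s : Prop := Invariant {
  inv_simple : simple (pairs s);
  inv_proposed m w : inl (m, w) \in pairs s -> (m, w) \in proposed s;
  inv_acceptable m w :
    (m, w) \in proposed s -> strictly (man_pref mkt m) (Some w) None;
  inv_above m w w' : (m, w) \in proposed s ->
    man_pref mkt m (Some w') (Some w) -> (m, w') \in proposed s;
  inv_single m w : inr (inl m) \in pairs s -> ~~ candidate mkt s m w;
  inv_man_quota m : size (man_partners (pairs s) m) <= man_quota mkt m;
  inv_woman_quota w : size (woman_partners (pairs s) w) = woman_quota mkt w;
  inv_woman_acceptable w y :
    y \in woman_partners (pairs s) w -> woman_pref mkt w y None;
  inv_rejected m w y :
    (m, w) \in proposed s -> inl (m, w) \notin pairs s ->
    y \in woman_partners (pairs s) w -> woman_pref mkt w y (Some m) }.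

Lemma man_refl m : reflexive (man_pref mkt m).
Proof. by move=> x; have := man_pref_total mkt m x x; rewrite orbb. Qed.

Lemma woman_refl w : reflexive (woman_pref mkt w).
Proof. by move=> x; have := woman_pref_total mkt w x x; rewrite orbb. Qed.

Lemma man_strictlyW m x y :
  strictly (man_pref mkt m) x y -> man_pref mkt m x y.
Proof. by move/negPf; have := man_pref_total mkt m x y => /[swap] ->; rewrite orbF. Qed.

Lemma woman_strictlyW w x y :
  strictly (woman_pref mkt w) x y -> woman_pref mkt w x y.
Proof. by move/negPf; have := woman_pref_total mkt w x y => /[swap] ->; rewrite orbF. Qed.

Lemma man_strict_trans m x y z :
  strictly (man_pref mkt m) x y -> man_pref mkt m y z ->
  strictly (man_pref mkt m) x z.
Proof. by move=> xy yz; apply: contra xy; apply: man_pref_trans. Qed.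

Lemma man_trans_strict m x y z :
  man_pref mkt m x y -> strictly (man_pref mkt m) y z ->
  strictly (man_pref mkt m) x z.
Proof. by move=> xy; apply: contra => zx; apply: man_pref_trans zx xy. Qed.

Lemma woman_strict_trans w x y z :
  strictly (woman_pref mkt w) x y -> woman_pref mkt w y z ->
  strictly (woman_pref mkt w) x z.
Proof. by move=> xy yz; apply: contra xy; apply: woman_pref_trans. Qed.

Lemma woman_strict_neq w x y :
  woman_pref mkt w x y -> x != y -> strictly (woman_pref mkt w) x y.
Proof.
move=> xy; apply: contra => yx; apply/eqP.
by apply: (hstrict.2 w); rewrite xy yx.
Qed.

Lemma willing_strictly s m w y :
  willing mkt s m w -> least_preferred mkt (pairs s) w y ->
  strictly (woman_pref mkt w) (Some m) y.
Proof. by case/hasP => z z_in mz [_ /(_ z z_in)]; apply: woman_strict_trans. Qed.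

Lemma unwilling_pref s m w y :
  ~~ willing mkt s m w -> y \in woman_partners (pairs s) w ->
  woman_pref mkt w y (Some m).
Proof. by move/hasPn => h /h; rewrite negbK. Qed.

(** * Preservation of the invariant *)

Lemma invariant_initial : invariant (initial_state mkt).
Proof.
have count_initial p : pairs (initial_state mkt) p =
    if p is inr (inr w) then woman_quota mkt w else 0.
  rewrite mset_seqE count_flatten -map_comp sumn_map big_enum /=.
  case: p => [[m w]|[m|w]].
  - by rewrite big1 // => v _; rewrite count_nseq.
  - by rewrite big1 // => v _; rewrite count_nseq.
  rewrite (bigD1 w) //= count_nseq /= eqxx mul1n big1 ?addn0 // => v vw.
  by rewrite count_nseq /= (inj_eq (@inr_inj _ _)) (inj_eq (@inr_inj _ _)) (negPf vw).
split=> [m w|m w|m w|m w w'|m w|m|w|w y|m w y]; rewrite ?in_set0 //.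
- by rewrite count_initial.
- by rewrite in_mset count_initial.
- by rewrite in_mset count_initial.
- by rewrite size_flatten_nseq big1 // => -[w|] _; rewrite count_initial.
- rewrite size_flatten_nseq (bigD1 None) //= count_initial big1 ?addn0 //.
  by case=> // m _; rewrite count_initial.
- by rewrite mem_woman_partners in_mset count_initial; case: y => // _; apply: woman_refl.
Qed.

(** A woman [v'] at least as good as [w] is acceptable too; had [m] not proposed to her, she would
    be a candidate, and strictness would identify her with the best one, [w]. *)
Lemma proposed_extended_above s m w m' v v' :
  invariant s -> best_candidate mkt s m w ->
  (m', v) \in (m, w) |: proposed s -> man_pref mkt m' (Some v') (Some v) ->
  (m', v') \in (m, w) |: proposed s.
Proof.
move=> inv [/andP[w_acc _] w_best]; rewrite !in_setU1 => /orP[/eqP[-> ->]|v_in] v'v.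
  have [//|v'_out] := boolP ((m, v') \in proposed s); first by rewrite orbT.
  have /w_best wv' : candidate mkt s m v'.
    by rewrite /candidate v'_out andbT; apply: man_trans_strict w_acc.
  suff [->] : Some v' = Some w by rewrite eqxx.
  by apply: (hstrict.1 m); rewrite v'v wv'.
by rewrite (inv_above inv v_in v'v) orbT.
Qed.

Lemma proposed_extended_acceptable s m w m' v :
  invariant s -> best_candidate mkt s m w ->
  (m', v) \in (m, w) |: proposed s -> strictly (man_pref mkt m') (Some v) None.
Proof.
move=> inv [/andP[w_acc _] _]; rewrite in_setU1 => /orP[/eqP[-> ->] //|].
exact: inv_acceptable.
Qed.

Lemma candidate_extended s mu p m w :
  candidate mkt (State mu (p |: proposed s)) m w -> candidate mkt s m w.
Proof. by rewrite /candidate /= in_setU1 negb_or => /and3P[-> _ ->]. Qed.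

(** Only an acceptance is delicate: the newcomer is strictly better than the displaced partner [y],
    and [y] is the worst one, so the spots of [w] only improve. *)
Lemma invariant_step s s' :
  invariant s -> PolyGS_step mkt s s' -> invariant s'.
Proof.
move=> inv; case=> {s'} [m|m w y|m w].
- move=> m_free m_done; split=> /= [m' w|m' w|m' w|m' w w'|m' w|m'|w|w y|m' w y].
  + by rewrite mset1DE; apply: (inv_simple inv).
  + by rewrite in_mset1D; apply: (inv_proposed inv).
  + exact: (inv_acceptable inv).
  + exact: (inv_above inv).
  + rewrite in_mset1D => /orP[/eqP[->]|]; first exact: m_done.
    exact: (inv_single inv).
  + rewrite (size_man_partners_add _ _ None); case: eqP => [->//|_].
    exact: (inv_man_quota inv).
  + rewrite -(inv_woman_quota inv) !size_flatten_nseq.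
    by apply: eq_bigr => -[?|] _; rewrite mset1DE.
  + rewrite mem_woman_partners in_mset1D => y_in.
    apply: (inv_woman_acceptable inv); rewrite mem_woman_partners.
    by case: y y_in.
  + rewrite mem_woman_partners !in_mset1D => /(inv_rejected inv) h /h {}h y_in.
    by apply: h; rewrite mem_woman_partners; case: y y_in.
- move=> m_free w_best m_will y_least.
  have [/andP[w_acc w_new] _] := w_best.
  have m_gt_y := willing_strictly m_will y_least.
  have [y_in y_le] := y_least.
  have m_notin : inl (m, w) \notin pairs s by apply: contra w_new; apply: inv_proposed.
  have in_new p : p \in man_pair m (Some w) +` (pairs s `\ woman_pair w y) ->
      p = inl (m, w) \/ p \in pairs s.
    by rewrite in_mset1D in_msetB1 => /orP[/eqP|/andP[_]]; [left|right].
  have partner_new v z :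
      z \in woman_partners (man_pair m (Some w) +` (pairs s `\ woman_pair w y)) v ->
      v = w /\ z = Some m \/ z \in woman_partners (pairs s) v.
    rewrite !mem_woman_partners => /in_new[/eqP|]; last by right.
    by rewrite -[inl _]/(woman_pair w (Some m)) woman_pair_inj => /andP[/eqP-> /eqP->]; left.
  split=> /= [m' v|m' v|m' v|m' v v'|m' v|m'|v|v z|m' v z].
  (* The proposal is new, so the pair had multiplicity 0 before being added. *)
  + rewrite mset1DE msetB1E; case: eqP => [->|_]; last first.
      by rewrite (leq_trans (leq_subr _ _)) ?(inv_simple inv).
    by rewrite (mset_eq0P m_notin).
  + by case/in_new => [[-> ->]|/(inv_proposed inv) h]; rewrite in_setU1 ?eqxx ?h ?orbT.
  + exact: proposed_extended_acceptable.
  + exact: proposed_extended_above.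
  + case/in_new => // /(inv_single inv) h.
    by apply: contra (h v); apply: candidate_extended.
  + have le_add : size (man_partners (man_pair m (Some w) +` (pairs s `\ woman_pair w y)) m')
        <= (m' == m) + size (man_partners (pairs s) m').
      rewrite size_man_partners_add leq_add2l !size_flatten_nseq.
      by apply: leq_sum => x _; rewrite msetB1E leq_subr.
    apply: leq_trans le_add _; case: eqP => [->//|_].
    exact: (inv_man_quota inv).
  + by rewrite size_woman_partners_swap // inv_woman_quota.
  + case/partner_new => [[-> ->]|]; last exact: (inv_woman_acceptable inv).
    apply: woman_strictlyW; apply: woman_strict_trans m_gt_y _.
    exact: (inv_woman_acceptable inv).
  + move=> m'_prop m'_out z_in.
    (* If [m'] was held before this step, he is the displaced [y], below [m] and below every old
       partner. Otherwise he was rejected earlier, hence is no better than [y], which [m] beats. *)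
    have [m'_in|m'_old] := boolP (inl (m', v) \in pairs s).
      have : inl (m', v) == woman_pair w y.
        apply: contraNT m'_out => h.
        by rewrite in_mset1D in_msetB1 (negPf h) m'_in orbT.
      rewrite -[inl _]/(woman_pair v (Some m')) woman_pair_inj => /andP[/eqP vw /eqP m'y].
      move: z_in; rewrite vw m'y => /partner_new[[_ ->]|/y_le//].
      exact: woman_strictlyW.
    have {m'_prop} m'_prop : (m', v) \in proposed s.
      move: m'_prop; rewrite in_setU1 => /orP[/eqP m'v|//].
      by move: m'_out; rewrite m'v in_mset1D eqxx.
    have old := inv_rejected inv m'_prop m'_old.
    case/partner_new: z_in => [[vw ->]|]; last exact: old.
    subst v; apply: woman_strictlyW; apply: woman_strict_trans m_gt_y _.
    exact: old.
- move=> m_free w_best m_unwill.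
  split=> /= [m' v|m' v|m' v|m' v v'|m' v|m'|v|v z|m' v z].
  + exact: (inv_simple inv).
  + by move/(inv_proposed inv); rewrite in_setU1 orbC => ->.
  + exact: proposed_extended_acceptable.
  + exact: proposed_extended_above.
  + move/(inv_single inv) => h.
    by apply: contra (h v); apply: candidate_extended.
  + exact: (inv_man_quota inv).
  + exact: (inv_woman_quota inv).
  + exact: (inv_woman_acceptable inv).
  + rewrite in_setU1 => /orP[/eqP[-> ->] _|]; last exact: (inv_rejected inv).
    exact: unwilling_pref.
Qed.

(** * Pairs of stable matchings are never rejected *)

Lemma card_wives s m : invariant s ->
  size (man_partners (pairs s) m) =
  #|wives (matching_of (pairs s)) m| + pairs s (inr (inl m)).
Proof.
move=> inv; rewrite (size_fill (A := wives (matching_of (pairs s)) m)).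
  by rewrite count_flatten_nseq.
by move=> w; apply/count_man_partners/inv_simple.
Qed.

Lemma card_husbands s w : invariant s ->
  woman_quota mkt w =
  #|husbands (matching_of (pairs s)) w| + pairs s (inr (inr w)).
Proof.
move=> inv; rewrite -(inv_woman_quota inv).
rewrite (size_fill (A := husbands (matching_of (pairs s)) w)).
  by rewrite count_flatten_nseq.
by move=> m; apply/count_woman_partners/inv_simple.
Qed.

(* The first time a woman drops a partner m that she has in nu, she prefers all
   her current partners to m, and one of them is a man m' outside nu; as m' has
   lost no partner in nu so far, (m', w) blocks nu. *)
Lemma rejected_not_stable s nu m w :
  invariant s -> stable_matching mkt nu ->
  (m, w) \in proposed s -> inl (m, w) \notin pairs s ->
  (forall m' w', w' != w -> (m', w') \in proposed s -> (m', w') \in nu ->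
     inl (m', w') \in pairs s) ->
  (m, w) \notin nu.
Proof.
move=> inv [nu_valid nu_stable] m_prop m_out others; apply/negP => m_nu.
have m_filled : Some m \in filled_woman mkt nu w.
  by rewrite mem_cat map_f // mem_enum inE.
have better y : y \in woman_partners (pairs s) w ->
    strictly (woman_pref mkt w) y (Some m).
  move=> y_in; apply: woman_strict_neq; first exact: (inv_rejected inv).
  by apply: contraNneq m_out => ym; move: y_in; rewrite ym mem_woman_partners.
have single0 : pairs s (inr (inr w)) = 0.
  apply/eqP; rewrite eqn0Ngt -in_mset; apply/negP => w_in; apply: nu_stable.
  exists (inr (inr w)); rewrite /=; apply/hasP; exists (Some m) => //.
  by apply: better; rewrite mem_woman_partners.
(* By cardinality, if all these men were her husbands in [nu], the two sets would coincide and [w]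
   would still hold [m]. *)
have /subsetPn[m' m'_in m'_out] :
    ~~ (husbands (matching_of (pairs s)) w \subset husbands nu w).
  apply/negP => sub; move: m_out; apply/negP; rewrite negbK.
  suff : m \in husbands (matching_of (pairs s)) w by rewrite !inE.
  suff /eqP -> : husbands (matching_of (pairs s)) w == husbands nu w by rewrite inE.
  rewrite eqEcard sub (leq_trans (nu_valid.1 w)) //.
  by rewrite (card_husbands w inv) single0 addn0.
move: m'_in m'_out; rewrite !inE => m'_in m'_out; apply: nu_stable.
have m'_prop := inv_proposed inv m'_in.
exists (inl (m', w)); apply/and3P; split=> //; last first.
  apply/hasP; exists (Some m) => //; apply: better; by rewrite mem_woman_partners.
apply: contraT => /hasPn not_better.
have nu_above x : x \in filled_man mkt nu m' -> man_pref mkt m' x (Some w).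
  by move=> /not_better; rewrite negbK.
(* A spare spot of [m'] in [nu] would rank himself above [w], who is acceptable to him. *)
have quota_le : man_quota mkt m' <= #|wives nu m'|.
  rewrite -subn_eq0 eqn0Ngt; apply/negP => quota_gt.
  have /nu_above : None \in filled_man mkt nu m'.
    by rewrite mem_cat mem_nseq quota_gt orbT.
  by apply/negP/(inv_acceptable inv).
(* If [m'] did not prefer [w] to some entry of [nu], he would have proposed to all his wives there
   and kept them; together with [w] they exceed his quota. *)
have sub : wives nu m' \proper wives (matching_of (pairs s)) m'.
  apply/properP; split; last by exists w; rewrite !inE.
  apply/subsetP => v; rewrite !inE => v_nu; apply: others => //.
    by apply: contraNneq m'_out => <-.
  apply: (inv_above inv m'_prop); apply: nu_above.
  by rewrite mem_cat map_f // mem_enum inE.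
have := leq_ltn_trans quota_le (proper_card sub).
rewrite ltnNge; case/negP; apply: leq_trans (inv_man_quota inv m').
by rewrite card_wives // leq_addr.
Qed.

Definition keeps_stable s : Prop := forall nu, stable_matching mkt nu ->
  forall m w, (m, w) \in proposed s -> (m, w) \in nu -> inl (m, w) \in pairs s.

(** A step affects the proposals and man-woman pairs of at most one woman. For all others the
    property carries over, which is what [rejected_not_stable] requires in order to treat her. *)
Lemma keeps_stable_step s s' : invariant s -> PolyGS_step mkt s s' ->
  keeps_stable s -> keeps_stable s'.
Proof.
move=> inv step keeps nu nu_stable.
have inv' := invariant_step inv step.
(* The witness is [None] when a man takes himself, as then no woman is affected. *)
have [w0 unchanged] : exists w0 : option W, forall m w, Some w != w0 ->
    ((m, w) \in proposed s') = ((m, w) \in proposed s) /\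
    (inl (m, w) \in pairs s') = (inl (m, w) \in pairs s).
  case: step {inv'} => [m _ _|m w y _ _ _ _|m w _ _ _].
  - by exists None => m' v _; rewrite in_mset1D.
  - exists (Some w) => m' v /negPf vw.
    rewrite in_setU1 in_mset1D in_msetB1 -[inl (m', v)]/(woman_pair v (Some m')).
    rewrite -[man_pair _ _]/(woman_pair w (Some m)) !woman_pair_inj xpair_eqE.
    by rewrite (inj_eq (@Some_inj _)) in vw; rewrite vw andbF.
  - exists (Some w) => m' v vw; rewrite in_setU1 xpair_eqE.
    by rewrite (inj_eq (@Some_inj _)) in vw; rewrite (negPf vw) andbF.
have away m w : Some w != w0 -> (m, w) \in proposed s' -> (m, w) \in nu ->
    inl (m, w) \in pairs s'.
  by move=> /unchanged h; rewrite (h m).1 (h m).2; apply: keeps.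
move=> m w m_prop m_nu.
have [w_w0|] := eqVneq (Some w) w0; last by move/away; apply.
apply: contraLR m_nu => m_out; apply: rejected_not_stable inv' _ _ _ _ => //.
by move=> m' w' w'w; apply: away; rewrite -w_w0 (inj_eq (@Some_inj _)).
Qed.

Lemma reachable_invariant s :
  clos_refl_trans _ (PolyGS_step mkt) (initial_state mkt) s ->
  invariant s /\ keeps_stable s.
Proof.
move=> run; elim: (clos_rt_rtn1 _ _ _ _ run) => [|s1 s2 step _ [inv keeps]].
  split; first exact: invariant_initial.
  by move=> nu _ m w; rewrite in_set0.
split; first exact: invariant_step step.
exact: keeps_stable_step step keeps.
Qed.

(** * Stability and optimality of the final state *)

(** If [x] is a woman, [m] has proposed to everyone above her; if [x] is [m] himself, he has run out
    of acceptable women. *)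
Lemma partner_above s m w x : invariant s ->
  x \in man_partners (pairs s) m -> strictly (man_pref mkt m) (Some w) x ->
  (m, w) \in proposed s.
Proof.
move=> inv; rewrite mem_man_partners; case: x => [v|] /=.
  move/(inv_proposed inv) => v_prop /man_strictlyW; exact: (inv_above inv).
by move/(inv_single inv) => /(_ w) + w_acc; rewrite /candidate w_acc negbK.
Qed.

Lemma partner_acceptable s m x : invariant s ->
  x \in man_partners (pairs s) m -> man_pref mkt m x None.
Proof.
move=> inv; rewrite mem_man_partners; case: x => [w|] /=; last by rewrite man_refl.
by move/(inv_proposed inv)/(inv_acceptable inv)/man_strictlyW.
Qed.

Section Final.
Variable s : state M W.
Hypotheses (inv : invariant s) (final : forall m, ~~ free_man mkt s m).
Let nu := matching_of (pairs s).

Lemma size_final_partners m : size (man_partners (pairs s) m) = man_quota mkt m.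
Proof.
apply/eqP; rewrite eqn_leq (inv_man_quota inv) /= leqNgt; exact: final.
Qed.

(** With no man free, the explicit self-pairs are exactly the copies of [m] that the convention
    fills in. *)
Lemma perm_filled_man m :
  perm_eq (man_partners (pairs s) m) (filled_man mkt nu m).
Proof.
rewrite /filled_man -(size_final_partners m); apply: perm_fill_size => w.
by apply/count_man_partners/inv_simple.
Qed.

Lemma perm_filled_woman w :
  perm_eq (woman_partners (pairs s) w) (filled_woman mkt nu w).
Proof.
rewrite /filled_woman -(inv_woman_quota inv w); apply: perm_fill_size => m.
by apply/count_woman_partners/inv_simple.
Qed.

(** In a blocking pair [(m, w)], [m] would have proposed to [w] without being held, so none of her
    spots is worse than [m]. Self-pairs cannot block because all partners held are acceptable. *)
Lemma final_stable : stable_matching mkt nu.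
Proof.
split; first split=> [w|m].
- by rewrite (card_husbands w inv) leq_addr.
- by rewrite -size_final_partners card_wives // leq_addr.
case=> -[[m w]|[m|w]] /=.
- case/and3P => mw_out /hasP[x x_in w_x] /hasP[y y_in m_y].
  rewrite -(perm_mem (perm_filled_man m)) in x_in.
  rewrite -(perm_mem (perm_filled_woman w)) in y_in.
  have := partner_above inv x_in w_x; rewrite inE in mw_out.
  by move/(inv_rejected inv)/(_ mw_out y_in)/(negP m_y).
- case/hasP => x; rewrite -(perm_mem (perm_filled_man m)) => x_in /negP; apply.
  exact: partner_acceptable x_in.
- case/hasP => y; rewrite -(perm_mem (perm_filled_woman w)) => y_in /negP; apply.
  exact: (inv_woman_acceptable inv).
Qed.

Lemma size_ranked_final m : size (ranked_man mkt nu m) = man_quota mkt m.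
Proof. by rewrite size_sort -(perm_size (perm_filled_man m)) size_final_partners. Qed.

(* If the i-th entry b of the rival list beat the i-th entry a of ours, the
   i + 1 rival entries at least as good as b would be women above a, to whom m
   has proposed and whom he has therefore kept. *)
Lemma final_optimal : keeps_stable s -> man_optimal mkt nu.
Proof.
move=> keeps nu' nu'_stable m i lt_i.
have size_filled : size (filled_man mkt nu' m) = man_quota mkt m.
  by rewrite size_cat size_map size_nseq -cardE subnKC // nu'_stable.1.2.
set a := nth _ _ i; set b := nth _ _ i.
(* This keeps the strict preference of [b] over [a] as a hypothesis while the goal remains that [a]
   is at least as good as [b]. *)
apply/negPn/negP => b_a; move: (b_a); apply/negP/negPn.
have a_in : a \in man_partners (pairs s) m.
  rewrite (perm_mem (perm_filled_man m)) -(mem_sort (man_pref mkt m)).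
  by rewrite mem_nth // size_ranked_final.
have count_b : i < count (fun x => man_pref mkt m x b) (ranked_man mkt nu' m).
  rewrite -(sorted_nth_count None (@man_pref_trans _ _ mkt m)) ?man_refl //.
    exact/sort_sorted/man_pref_total.
  by rewrite size_sort size_filled.
rewrite (sorted_nth_count None (@man_pref_trans _ _ mkt m)); last 2 first.
- exact/sort_sorted/man_pref_total.
- by rewrite size_ranked_final.
apply: leq_trans count_b _; rewrite !count_sort !count_cat.
(* Since [b] is strictly better than [m] himself, the filler entries do not count and only wives
   have to be compared. *)
have /negPf b_acc : strictly (man_pref mkt m) b None.
  by apply: man_strict_trans b_a _; apply: partner_acceptable a_in.
rewrite [X in _ + X <= _]count_nseq /= b_acc addn0.
apply: leq_trans (leq_addr _ _); rewrite !count_map.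
rewrite -!size_filter; apply: uniq_leq_size; first by rewrite filter_uniq ?enum_uniq.
move=> w; rewrite mem_filter mem_enum inE => /andP[w_b w_nu'].
rewrite mem_filter mem_enum !inE w_b /=.
rewrite inE in w_nu'; apply: (keeps nu' nu'_stable) (w_nu').
by apply: partner_above inv a_in _; apply: man_trans_strict b_a.
Qed.

End Final.

(** * Progress and termination *)

Lemma exists_best_candidate s m w :
  candidate mkt s m w -> exists v, best_candidate mkt s m v.
Proof.
move=> w_cand; pose ge v v' := man_pref mkt m (Some v) (Some v').
pose c := enum (candidate mkt s m).
have c_sorted : sorted ge (sort ge c).
  by apply: sort_sorted => v v'; apply: man_pref_total.
have mem_c v : (v \in sort ge c) = candidate mkt s m v by rewrite mem_sort mem_enum.
case c_def : (sort ge c) => [|v r]; first by move: w_cand; rewrite -mem_c c_def.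
exists v; split; first by rewrite -mem_c c_def mem_head.
move=> v'; rewrite -mem_c c_def in_cons => /orP[/eqP ->|]; first exact: man_refl.
move: c_sorted; rewrite c_def => /(order_path_min _) /allP; apply.
by move=> ? ? ?; apply: man_pref_trans.
Qed.

Lemma exists_least_preferred s m w : willing mkt s m w ->
  exists y, least_preferred mkt (pairs s) w y.
Proof.
(* The order is reversed so that the head of the sorted list is the worst partner. *)
case/hasP => z z_in _; pose le y y' := woman_pref mkt w y' y.
pose c := woman_partners (pairs s) w.
have c_sorted : sorted le (sort le c).
  by apply: sort_sorted => y y'; apply: woman_pref_total.
have mem_c y : (y \in sort le c) = (y \in c) by rewrite mem_sort.
case c_def : (sort le c) => [|y r]; first by move: z_in; rewrite -mem_c c_def.
exists y; split; first by rewrite -mem_c c_def mem_head.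
move=> y'; rewrite -mem_c c_def in_cons => /orP[/eqP ->|]; first exact: woman_refl.
move: c_sorted; rewrite c_def => /(order_path_min _) /allP; apply.
by move=> y1 y2 y3 y12 y13; apply: woman_pref_trans y13 y12.
Qed.

Lemma exists_step s m : free_man mkt s m -> exists s', PolyGS_step mkt s s'.
Proof.
move=> m_free; have [/existsP[w /exists_best_candidate[v v_best]]|] :=
  boolP [exists w, candidate mkt s m w].
  have [v_will|v_unwill] := boolP (willing mkt s m v).
    have [y y_least] := exists_least_preferred v_will.
    by eexists; apply: step_accept v_best v_will y_least.
  by eexists; apply: step_reject v_best v_unwill.
by rewrite negb_exists => /forallP none; eexists; apply: step_self none.
Qed.

(** Termination measure: proposals not yet made, plus spots that men have not yet given to
    themselves. *)
Definition remaining s : nat :=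
  #|~: proposed s| + \sum_m (man_quota mkt m - pairs s (inr (inl m))).

Lemma remaining_decreases s s' : PolyGS_step mkt s s' -> remaining s' < remaining s.
Proof.
have proposed_decreases m w : best_candidate mkt s m w ->
    #|~: ((m, w) |: proposed s)| < #|~: proposed s|.
  case=> /andP[_ w_new] _; apply/proper_card/properP; split.
    by rewrite setCS subsetUr.
  by exists (m, w); rewrite !inE ?eqxx.
case=> {s'} [m m_free _|m w y _ w_best _ _|m w _ w_best _].
- rewrite /remaining /= ltn_add2l (bigD1 m) //= [ltnRHS](bigD1 m) //=.
  rewrite (eq_bigr (fun m' => man_quota mkt m' - pairs s (inr (inl m')))); last first.
    move=> m' /negPf m'm.
    by rewrite mset1DE (inj_eq (@inr_inj _ _)) (inj_eq (@inl_inj _ _)) m'm.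
  (* Truncated subtraction drops strictly here because a free man has fewer self-pairs than his
     quota. *)
  rewrite ltn_add2r mset1DE eqxx; apply: ltn_sub2l => //.
  apply: leq_ltn_trans m_free; rewrite size_flatten_nseq (bigD1 None) //=.
  exact: leq_addr.
- rewrite /remaining /= -addSn leq_add ?proposed_decreases //.
  by apply: leq_sum => m' _; rewrite mset1DE msetB1E; case: y => [?|]; rewrite /= subn0.
- by rewrite /remaining /= ltn_add2r proposed_decreases.
Qed.

Lemma PolyGS_terminates s :
  exists2 t, clos_refl_trans _ (PolyGS_step mkt) s t & forall m, ~~ free_man mkt t m.
Proof.
have [n] := ubnP (remaining s); elim: n s => // n IHn s lt_n.
have [/existsP[m /exists_step[s' step]]|] := boolP [exists m, free_man mkt s m].
  have [|t run t_final] := IHn s'.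
    by apply: leq_trans (remaining_decreases step) _.
  by exists t => //; apply: rt_trans run; apply: rt_step.
by rewrite negb_exists => /forallP final; exists s => //; apply: rt_refl.
Qed.

(** * Optimality and uniqueness of the result *)

Lemma returned_optimal mu :
  PolyGS_returns mkt mu -> man_optimal mkt (matching_of mu).
Proof.
case=> s [/reachable_invariant[inv keeps] final ->]; exact: final_optimal.
Qed.

Lemma returned_unique mu1 mu2 :
  PolyGS_returns mkt mu1 -> PolyGS_returns mkt mu2 -> mu1 = mu2.
Proof.
case=> s1 [/reachable_invariant[inv1 keeps1] final1 ->].
case=> s2 [/reachable_invariant[inv2 keeps2] final2 ->].
have ranked_eq m : ranked_man mkt (matching_of (pairs s1)) m =
                   ranked_man mkt (matching_of (pairs s2)) m.
  apply: (@eq_from_nth _ None); rewrite !size_ranked_final // => i lt_i.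
  apply: (hstrict.1 m); apply/andP; split.
    by apply: (final_optimal inv1) => //; apply: final_stable.
  by apply: (final_optimal inv2) => //; apply: final_stable.
(* A ranked list determines the multiplicity of every pair involving [m], self-pairs included. *)
have men_eq m x : pairs s1 (man_pair m x) = pairs s2 (man_pair m x).
  have count_ranked s : invariant s -> (forall m, ~~ free_man mkt s m) ->
      pairs s (man_pair m x) = count_mem x (ranked_man mkt (matching_of (pairs s)) m).
    move=> inv final; rewrite count_sort -(permP (perm_filled_man inv final m)).
    by rewrite count_flatten_nseq.
  by rewrite !count_ranked ?ranked_eq.
apply/msetP => -[[m w]|[m|w]]; first exact: (men_eq m (Some w)).
  exact: (men_eq m None).
(* The men's lists do not show the self-pairs of [w]; their number is her quota minus the number of
   her husbands. *)
have : husbands (matching_of (pairs s1)) w = husbands (matching_of (pairs s2)) w.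
  by apply/setP => m; rewrite !inE !in_mset (men_eq m (Some w)).
have := card_husbands w inv1; rewrite (card_husbands w inv2) => /[swap] ->.
by move/addnI.
Qed.

End Market.

Theorem proposition6 (M W : finType) (mkt : market M W)
    (hstrict : strict_preferences mkt) :
  (forall mu : {mset pairing M W},
      PolyGS_returns mkt mu -> man_optimal mkt (matching_of mu)) /\
  (exists! mu : {mset pairing M W}, PolyGS_returns mkt mu).
Proof.
split; first exact: returned_optimal.
(* Existence of a result comes from termination of some run from the initial state. *)
have [s run final] := PolyGS_terminates mkt (initial_state mkt).
have returned : PolyGS_returns mkt (pairs s) by exists s.
by exists (pairs s); split=> // mu; apply: returned_unique.
Qed.
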